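(* Let $G$ be a connected graph with root $r$ such that $G$ satisfies the rooted triangle condition. If every daisy graph of $G$ with respect to $r$ is isometric in $G$, then for any $u,v\in V(G)$ there exists a pseudo-median in $G$ of size $0$ or $1$ of the triple $(u,v,r)$.
   Context: Distances are shortest-path distances; $I_G(a,b)=\{x: d(a,x)+d(x,b)=d(a,b)\}$. A subgraph is isometric if it preserves distances. For $X\subseteq V(G)$, the daisy graph $G_r(X)$ of $G$ with respect to $r$ is the subgraph of $G$ induced by $\bigcup_{v\in X} I_G(r,v)$. $G$ satisfies the rooted triangle condition (with respect to $r$) if for any two adjacent vertices $v,w$ with $d(r,v)=d(r,w)\ge 2$ there exists a vertex $x$ adjacent to both $v$ and $w$ with $d(x,r)=d(r,v)-1$. A triple $(x,y,z)$ is a pseudo-median of $(u,v,w)$ if: (1) some shortest $u,v$-path contains $x,y$, some shortest $v,w$-path contains $y,z$, and some shortest $u,w$-path contains $x,z$; (2) $d(x,y)=d(y,z)=d(x,z)$; (3) $d(x,y)$ is minimal subject to (1),(2). Its size is $d(x,y)$. *)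

(* Defs.v *)
(* A graph is a symmetric irreflexive [e : rel V] on an [eqType] V, which need
   not be finite. *)
From mathcomp Require Import all_boot.
From mathcomp Require Import boolp classical_sets.

Set Implicit Arguments.
Unset Strict Implicit.
Unset Printing Implicit Defensive.

Local Open Scope classical_set_scope.

Section Distance.
Variables (T : Type) (e : rel T).

Definition walk_of_length (x y : T) (n : nat) : Prop :=
  exists p : seq T, [/\ path e x p, last x p = y & size p = n].

Definition reachable (x y : T) : Prop := exists n, walk_of_length x y n.

Definition connected_graph : Prop := forall x y, reachable x y.

(* Meaningful only when [reachable x y]; the default value is 0. *)
Definition dist (x y : T) : nat :=
  xget 0 [set n | walk_of_length x y n /\
                  forall m, walk_of_length x y m -> n <= m].

Definition interval (a b : T) : set T :=
  [set x | dist a x + dist x b = dist a b].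

End Distance.

Section Daisy.
Variables (V : eqType) (e : rel V).

Definition induced (S : set V) : rel {x : V | x \in S} :=
  fun x y => e (val x) (val y).

(* The reachability clause excludes the default value of [dist] in a
   disconnected subgraph. *)
Definition isometric (S : set V) : Prop :=
  forall x y : {x : V | x \in S},
    (reachable e (val x) (val y) -> reachable (@induced S) x y) /\
    dist (@induced S) x y = dist e (val x) (val y).

Definition daisy (r : V) (X : set V) : set V :=
  \bigcup_(v in X) interval e r v.

Definition rooted_triangle_condition (r : V) : Prop :=
  forall v w : V, e v w -> dist e r v = dist e r w -> 2 <= dist e r v ->
    exists x : V, [/\ e x v, e x w & dist e x r = dist e r v - 1].

Definition shortest_path (a b : V) (p : seq V) : Prop :=
  [/\ path e a p, last a p = b & size p = dist e a b].

(* The vertex sequence of the path starting at [a] with tail [p] is [a :: p];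
   no order of [x] and [y] along the path is imposed. *)
Definition on_common_shortest_path (a b x y : V) : Prop :=
  exists p : seq V, [/\ shortest_path a b p, x \in a :: p & y \in a :: p].

Definition pseudo_median_candidate (u v w x y z : V) : Prop :=
  [/\ on_common_shortest_path u v x y,
      on_common_shortest_path v w y z,
      on_common_shortest_path u w x z,
      dist e x y = dist e y z & dist e y z = dist e x z].

Definition pseudo_median (u v w x y z : V) : Prop :=
  pseudo_median_candidate u v w x y z /\
  forall x' y' z' : V, pseudo_median_candidate u v w x' y' z' ->
    dist e x y <= dist e x' y'.

End Daisy.

(* Main.v *)
(** Apply isometry to the daisy graph of [{u, v}]: it contains a shortest
    [u,v]-path of [G], all of whose vertices lie in [I(r,u)] or [I(r,v)].
    If a vertex [m] of it lies in both intervals, then [(m, m, m)] is a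
    pseudo-median of size 0. Otherwise the path crosses an edge [xy] with [x] in
    [I(r,u)] only and [y] in [I(r,v)] only. Then [x] and [y] are at the same
    distance [k >= 1] from [r], and they have a common neighbour [z] at distance
    [k - 1]: the root itself if [k = 1], and a vertex given by the triangle
    condition if [k >= 2]. So [(x, y, z)] satisfies (1) and (2) with size 1, and
    a pseudo-median has size at most 1. *)
Require Import Defs.
From mathcomp Require Import all_boot.
From mathcomp Require Import boolp classical_sets.
From mathcomp Require Import zify.

Set Implicit Arguments.
Unset Strict Implicit.
Unset Printing Implicit Defensive.

Section Walks.
Variables (T : Type) (e : rel T).

Lemma dist_walk x y : reachable e x y -> walk_of_length e x y (dist e x y).
Proof.
move=> [n wn].
pose P m := `[< walk_of_length e x y m >].
have exP : exists m, P m by exists n; apply/asboolP.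
(* The default case of [xget] is impossible: a least walk length exists. *)
rewrite /dist; case: xgetP => [d _ [] //|H].
case: (ex_minnP exP) => m /asboolP wm minm.
by case: (H m); split=> // k /asboolP; exact: minm.
Qed.

Lemma dist_le x y n : walk_of_length e x y n -> dist e x y <= n.
Proof.
by move=> wn; rewrite /dist; case: xgetP => [m _ [_ minm]|//]; exact: minm.
Qed.

Lemma walk_cat x y z m n :
  walk_of_length e x y m -> walk_of_length e y z n ->
  walk_of_length e x z (m + n).
Proof.
move=> [p [pp lp <-]] [q [pq lq <-]]; exists (p ++ q).
by rewrite cat_path last_cat size_cat lp pp.
Qed.

Lemma walk_rev x y n :
  symmetric e -> walk_of_length e x y n -> walk_of_length e y x n.
Proof.
move=> e_sym [p [pp <- <-]]; exists (rev (belast x p)); split.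
- by rewrite rev_path (@eq_path _ _ e).
- by case: p {pp} => //= a p; rewrite rev_cons last_rcons.
- by rewrite size_rev size_belast.
Qed.

(** Take the first vertex of [p] that satisfies [B]: its predecessor is [x] or a vertex outside [B],
    so it satisfies [A]. The left disjunct covers the empty walk. *)
Lemma walk_crossing (A B : T -> Prop) x p :
  path e x p -> A x -> B (last x p) ->
  (forall i, i < size p -> A (nth x p i) \/ B (nth x p i)) ->
  (A x /\ B x) \/
  exists p1 y p2,
    [/\ p = p1 ++ y :: p2, e (last x p1) y, A (last x p1) & B y].
Proof.
elim: p x => [|y p IH] x /=; first by left.
case/andP=> exy pyp Ax Bl AB; right.
have [By|nBy] := pselect (B y); first by exists [::], y, p.
have Ay : A y by case: (AB 0 isT).
case: (IH y) => //.
- move=> i ip; rewrite (set_nth_default x) //.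
  exact: (AB i.+1).
- by case.
- by move=> [p1 [z [p2 [-> ? ? ?]]]]; exists (y :: p1), z, p2.
Qed.

End Walks.

Section ConnectedGraph.
Variables (V : eqType) (e : rel V).
Hypotheses (e_sym : symmetric e) (e_irr : irreflexive e).
Hypothesis e_conn : connected_graph e.

Local Notation d := (dist e).

Lemma distxx x : d x x = 0.
Proof. by apply/eqP; rewrite -leqn0; apply: dist_le; exists [::]. Qed.

Lemma distC x y : d x y = d y x.
Proof.
by apply/eqP; rewrite eqn_leq !dist_le //; apply: walk_rev => //;
  exact: dist_walk.
Qed.

Lemma dist_triangle y x z : d x z <= d x y + d y z.
Proof. by apply: dist_le; apply: walk_cat; exact: dist_walk. Qed.

Lemma dist0_eq x y : d x y = 0 -> x = y.
Proof.
move=> d0; have [p [_ lp]] := dist_walk (e_conn x y).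
by rewrite d0; case: p lp.
Qed.

Lemma dist_edge x y : e x y -> d x y = 1.
Proof.
move=> exy; apply/eqP; rewrite eqn_leq; apply/andP; split.
  by apply: dist_le; exists [:: y]; rewrite /= exy.
by rewrite lt0n; apply/eqP => /dist0_eq xy; rewrite xy e_irr in exy.
Qed.

Lemma dist1_edge x y : d x y = 1 -> e x y.
Proof.
move=> d1; have [p [pp lp]] := dist_walk (e_conn x y).
rewrite d1; case: p pp lp => [|z [|//]] //=.
by rewrite andbT => ez <-.
Qed.

(** Shortest walks from [a] to [x], [x] to [y] and [y] to [b] concatenate to a walk of length
    [d a b]. This turns condition (1) into arithmetic of distances. *)
Lemma on_common_shortest_path_dist a b x y :
  d a x + d x y + d y b = d a b -> on_common_shortest_path e a b x y.
Proof.
move=> E.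
have [p [pp lp sp]] := dist_walk (e_conn a x).
have [q [pq lq sq]] := dist_walk (e_conn x y).
have [s [ps ls ss]] := dist_walk (e_conn y b).
have xin : x \in a :: p by rewrite -lp mem_last.
have yin : y \in x :: q by rewrite -lq mem_last.
exists (p ++ q ++ s); split.
- split; first by rewrite !cat_path lp lq pp pq.
  + by rewrite !last_cat lp lq.
  + by rewrite !size_cat; lia.
- by rewrite -cat_cons mem_cat xin.
- move: yin; rewrite inE => /orP[/eqP->|yq].
    by rewrite -cat_cons mem_cat xin.
  by rewrite inE !mem_cat yq !orbT.
Qed.

(** A shortest path from [r] to [x] may be chosen through [y], and continuing it from [x] to [u]
    keeps it shortest. *)
Lemma interval_down r u x y :
  e x y -> interval e r u x -> d r x = (d r y).+1 -> interval e r u y.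
Proof.
rewrite /interval /= => exy xu E.
have := dist_triangle y r u; have := dist_triangle x y u.
by rewrite (distC y x) (dist_edge exy); lia.
Qed.

Lemma shortest_path_daisy r u v :
  isometric e (daisy e r [set u; v]%classic) ->
  exists2 p, shortest_path e u v p &
    forall i, i < size p ->
      interval e r u (nth u p i) \/ interval e r v (nth u p i).
Proof.
set S := daisy _ _ _ => isoS.
have uS : u \in S.
  by rewrite inE; exists u; [left|rewrite /interval /= distxx addn0].
have vS : v \in S.
  by rewrite inE; exists v; [right|rewrite /interval /= distxx addn0].
(* [reach] provides an actual walk inside the daisy graph, so that the equality [dS] does not
   concern a default value. *)
have [reach dS] := isoS (exist _ u uS) (exist _ v vS).
have [p [pp lp sp]] := dist_walk (reach (e_conn u v)).
exists (map val p).
- split; last by rewrite size_map sp dS.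
  + have -> : u = val (exist (fun x => x \in S) u uS) by [].
    by rewrite path_map.
  + have -> : u = val (exist (fun x => x \in S) u uS) by [].
    by rewrite last_map lp.
- move=> i; rewrite size_map => ip.
  rewrite (nth_map (exist _ u uS)) //; set w := nth _ _ _.
  by have := svalP w; rewrite inE => -[a [->|->]]; [left|right].
Qed.

Lemma median_candidate r u v m p :
  shortest_path e u v p -> m \in u :: p ->
  interval e r u m -> interval e r v m ->
  pseudo_median_candidate e u v r m m m.
Proof.
rewrite /interval /= => sp mp mu mv; split=> //.
- by exists p.
- apply: on_common_shortest_path_dist.
  by rewrite distxx (distC v m) (distC m r) (distC v r); lia.
- apply: on_common_shortest_path_dist.
  by rewrite distxx (distC u m) (distC m r) (distC u r); lia.
Qed.

Lemma common_lower_neighbour r x y :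
  rooted_triangle_condition e r -> e x y -> d r x = d r y ->
  exists z, [/\ e x z, e y z & (d z r).+1 = d r x].
Proof.
move=> tri exy E.
have [k2|k1] := leqP 2 (d r x).
  have [z [zx zy zr]] := tri x y exy E k2.
  by exists z; rewrite e_sym zx e_sym zy; split=> //; lia.
(* Distance 0 would make both ends of the edge equal to [r]; the only case left is distance 1, where
   the root is the common neighbour. *)
have k0 : d r x != 0.
  apply/eqP => rx0; have rx := dist0_eq rx0.
  have /dist0_eq ry : d r y = 0 by rewrite -E.
  by rewrite -rx -ry e_irr in exy.
by exists r; rewrite distxx; split;
  first [apply: dist1_edge; rewrite distC; lia | lia].
Qed.

Lemma exists_small_candidate r u v :
  rooted_triangle_condition e r ->
  isometric e (daisy e r [set u; v]%classic) ->
  exists x y z, pseudo_median_candidate e u v r x y z /\ d x y <= 1.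
Proof.
move=> tri /shortest_path_daisy [p sp AB].
have [pp lp _] := sp.
have uu : interval e r u u by rewrite /interval /= distxx addn0.
have vv : interval e r v (last u p) by rewrite lp /interval /= distxx addn0.
suff [[m [mp mu mv]]|[x [y [xyp exy xu yv E]]]] :
    (exists m, [/\ m \in u :: p, interval e r u m & interval e r v m]) \/
    exists x y, [/\ (x \in u :: p) && (y \in u :: p), e x y,
      interval e r u x, interval e r v y & d r x = d r y].
- exists m, m, m; rewrite distxx; split=> //.
  exact: median_candidate sp mp mu mv.
- have [z [xz yz zr]] := common_lower_neighbour tri exy E.
  exists x, y, z; rewrite (dist_edge exy); split=> //.
  rewrite /interval /= in xu yv; case/andP: xyp => xp yp.
  (* The path [p] serves the pair [x], [y]; for the other two pairs, [z] is one step further towards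
     [r] on a shortest path from [v] through [y], and from [u] through [x]. *)
  split; rewrite ?(dist_edge exy) ?(dist_edge xz) ?(dist_edge yz) //.
  + by exists p.
  + apply: on_common_shortest_path_dist.
    by rewrite (dist_edge yz) (distC v y) (distC v r); lia.
  + apply: on_common_shortest_path_dist.
    by rewrite (dist_edge xz) (distC u x) (distC u r); lia.
have [[_ uv]|[p1 [y [p2 [pE exy xu yv]]]]] := walk_crossing pp uu vv AB.
  by left; exists u; rewrite mem_head.
move: exy xu; set x := last u p1 => exy xu.
have xp : x \in u :: p by rewrite pE -cat_cons mem_cat mem_last.
have yp : y \in u :: p by rewrite pE inE mem_cat mem_head !orbT.
have eyx : e y x by rewrite e_sym.
(* The levels of [x] and [y] differ by at most 1. If they differ, the end nearer to [r] lies in both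
   intervals by [interval_down]. *)
have := dist_triangle x r y; have := dist_triangle y r x.
rewrite (dist_edge exy) (dist_edge eyx) => l1 l2.
have [lt|lt|eq] := ltngtP (d r x) (d r y).
- left; exists x; split=> //.
  by apply: interval_down eyx yv _; lia.
- left; exists y; split=> //.
  by apply: interval_down exy xu _; lia.
- by right; exists x, y; rewrite xp yp.
Qed.

End ConnectedGraph.

Theorem theorem2p6 (V : eqType) (e : rel V) (r : V)
    (e_sym : symmetric e) (e_irr : irreflexive e)
    (e_conn : connected_graph e)
    (e_tri : rooted_triangle_condition e r)
    (daisy_iso : forall X : set V, isometric e (daisy e r X)) :
  forall u v : V, exists x y z : V,
    pseudo_median e u v r x y z /\ (dist e x y = 0 \/ dist e x y = 1).
Proof.
move=> u v.
have [x [y [z [cxyz xy1]]]] :=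
  exists_small_candidate e_sym e_irr e_conn e_tri (daisy_iso [set u; v]%classic).
(* Minimality: a candidate of size 0 is minimal, and if there is none, every candidate has size at
   least 1, so the one found is minimal. *)
have [[x' [y' [z' [c0 d0]]]]|no0] := pselect (exists x' y' z',
    pseudo_median_candidate e u v r x' y' z' /\ dist e x' y' = 0).
  exists x', y', z'; split; last by left.
  by split=> // *; rewrite d0.
exists x, y, z; split; last by case: (dist e x y) xy1 => [|[|//]]; auto.
split=> // x' y' z' c'; apply: leq_trans xy1 _.
by rewrite lt0n; apply/eqP => d0; apply: no0; exists x', y', z'.
Qed.
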